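(* Let $\kappa$ be a cardinal and let $K\subseteq 2^\kappa$ be a compact space satisfying the countable chain condition. Let \[\widetilde{K}=\{x\in 2^\kappa:\ \text{there is } y\in K \text{ with } x(\alpha)\le y(\alpha)\text{ for all }\alpha<\kappa\}\] be the adequate closure of $K$. Then $\widetilde K$ belongs to $\mathrm{WRNB}^\perp$, i.e. the Boolean algebra of clopen subsets of $\widetilde K$ contains no uncountable subalgebra whose Stone space is weakly Radon-Nikodým.
   Context: A compact space is ccc if it contains no uncountable family of pairwise disjoint nonempty open sets. A compact space is weakly Radon-Nikodým (WRN) if it is homeomorphic to a weak$^*$ compact subset of the dual $X^*$ of a Banach space $X$ containing no isomorphic copy of $\ell_1$. A Boolean algebra is WRN if its Stone space is WRN. For a class $\mathcal C$ of Boolean algebras, $\mathcal C^\perp$ is the class of Boolean algebras containing no uncountable subalgebra in $\mathcal C$; a zero-dimensional compact space is said to belong to $\mathrm{WRNB}^\perp$ if its algebra of clopen sets belongs to $\mathrm{WRNB}^\perp$, where $\mathrm{WRNB}$ is the class of WRN Boolean algebras. *)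

(* Defs.v *)
From HB Require Import structures.
From mathcomp Require Import all_boot all_order all_algebra.
From mathcomp Require Import all_classical all_reals all_analysis.
From mathcomp Require Import Rstruct Rstruct_topology.
Set Implicit Arguments. Unset Strict Implicit. Unset Printing Implicit Defensive.
Import Order.TTheory GRing.Theory Num.Theory.
Import numFieldNormedType.Exports.
Local Open Scope classical_set_scope.
Local Open Scope ring_scope.

Notation R := Rdefinitions.R.

Definition cube (I : Type) : Type := prod_topology (fun _ : I => bool).
HB.instance Definition _ (I : Type) := Topological.on (cube I).

Definition open_in {T : topologicalType} (A U : set T) : Prop :=
  exists V : set T, open V /\ U = A `&` V.

Definition clopen_in {T : topologicalType} (A U : set T) : Prop :=
  U `<=` A /\ open_in A U /\ open_in A (A `\` U).

Definition ccc {T : topologicalType} (A : set T) : Prop :=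
  forall F : set (set T),
    (forall U, F U -> open_in A U /\ U !=set0) ->
    (forall U V, F U -> F V -> U <> V -> U `&` V = set0) ->
    countable F.

Definition adequate_closure (I : Type) (K : set (cube I)) : set (cube I) :=
  [set x | exists2 y, K y & forall a : I, (x a ==> y a)].

Definition clopen_subalgebra {T : topologicalType} (L : set T)
    (B : set (set T)) : Prop :=
  [/\ forall U, B U -> clopen_in L U,
      B set0, B L,
      (forall U V, B U -> B V -> B (U `|` V)) &
      (forall U, B U -> B (L `\` U))].

(** Stone space of such a subalgebra B, realized as the space of Boolean
    homomorphisms B -> 2 (with the topology of pointwise convergence);
    coordinates outside B are fixed to false. *)
Definition stone_space {T : topologicalType} (L : set T) (B : set (set T))
  : set (prod_topology (fun _ : set T => bool)) :=
  [set h | [/\ h L = true, h set0 = false,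
     (forall U V, B U -> B V -> h (U `|` V) = h U || h V),
     (forall U, B U -> h (L `\` U) = ~~ h U) &
     (forall U, ~ B U -> h U = false)]].

Definition l1_seq (a : nat -> R) : Prop :=
  cvgn (series (fun k => `|a k|)).
Definition l1_norm (a : nat -> R) : R := limn (series (fun k => `|a k|)).

Definition contains_l1 (X : normedModType R) : Prop :=
  exists (L : (nat -> R) -> X) (c C : R),
    [/\ 0 < c,
        (forall (r : R) a b, l1_seq a -> l1_seq b ->
           L (fun k => r * a k + b k) = r *: L a + L b) &
        (forall a, l1_seq a ->
           c * l1_norm a <= `|L a| /\ `|L a| <= C * l1_norm a)].

(** A subset S of a topological space is weakly Radon-Nikodym: it is
    homeomorphic to a weak* compact subset of the dual X* of a real Banach
    space X containing no isomorphic copy of l^1.  X* is viewed inside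
    {ptws X -> R}, whose topology induces the weak* topology. *)
Definition WRN {T : topologicalType} (S : set T) : Prop :=
  exists (X : completeNormedModType R) (f : T -> {ptws X -> R}),
    [/\ ~ contains_l1 X,
        (forall t, S t ->
           (forall (r : R) (x y : X), f t (r *: x + y) = r * f t x + f t y)
           /\ continuous (f t : X -> R)),
        (forall s t, S s -> S t -> f s = f t -> s = t),
        {within S, continuous f} &
        compact (f @` S) /\
        exists g : {ptws X -> R} -> T,
          (forall t, S t -> g (f t) = t) /\ {within f @` S, continuous g}].

Definition in_WRNB_perp {T : topologicalType} (L : set T) : Prop :=
  forall B : set (set T), clopen_subalgebra L B -> ~ countable B ->
    ~ WRN (stone_space L B).

(* Main.v *)
(** Write L for the adequate closure of K, and suppose that an uncountable
    algebra B of clopen subsets of L has a Stone space S embedded in the dual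
    of X.  Every v in X induces a continuous function g_v on L, through the
    canonical map L -> S.

    Clopen subsets of L have finite supports; by the Delta-system lemma there
    are uncountably many U in B with points w_U in L whose supports are
    pairwise disjoint outside a common part z, and U separates w_U from z.
    Hence some x_U in X satisfies g_{x_U}(w_U) - g_{x_U}(z) = 1, and we may
    assume the norms |x_U| bounded.  Up to 1/4 the function g_{x_U} depends on
    a finite set G_U of coordinates; a second Delta-system makes w_V agree with
    z on G_U for V <> U.  By ccc some infinite sequence among the clopen sets
    {y in K : w_U <= y} is centered, and then every join of z with finitely
    many w_U of this sequence lies in L.  Such joins realize every pattern of
    values of finitely many g_{x_U}, near g_{x_U}(w_U) or near g_{x_U}(z) at
    will, so the x_U of the sequence span a copy of l^1 in X. *)

From HB Require Import structures.
Require Import Defs.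
From mathcomp Require Import all_boot all_order all_algebra.
From mathcomp Require Import finmap.
From mathcomp Require Import all_classical all_reals all_analysis.
From mathcomp Require Import Rstruct Rstruct_topology ring lra.
Import Order.TTheory GRing.Theory Num.Theory numFieldNormedType.Exports.
Local Open Scope classical_set_scope.
Local Open Scope ring_scope.

(** * Uncountable index sets and Delta-systems *)

Lemma uncountable_fiber (T : Type) (C : countType) (h : T -> C) (J : set T) :
  ~ countable J -> exists c, ~ countable (J `&` h @^-1` [set c]).
Proof.
move=> ncJ; apply: contrapT => /forallNP cfib; apply: ncJ.
have -> : J = \bigcup_(c in [set: C]) (J `&` h @^-1` [set c]).
  by apply/seteqP; split=> [i Ji|i [c _ []]//]; exists (h i).
apply: bigcup_countable => [|c _]; first exact: countableP.
exact: contrapT (cfib c).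
Qed.

Lemma uncountable_two (T : Type) (J : set T) :
  ~ countable J -> exists i j, [/\ J i, J j & i <> j].
Proof.
move=> ncJ.
have [i Ji] : J !=set0.
  by apply/set0P/eqP => J0; apply: ncJ; rewrite J0; exact: countable0.
have : ~ (J `<=` [set i]).
  by move=> /subset_card_le sJi; apply: ncJ; apply: sub_countable sJi _; exact: countable1.
by move=> /existsNP[j /not_implyP[Jj /= ji]]; exists j, i.
Qed.

Lemma countable_setU (T : Type) (A B : set T) :
  countable A -> countable B -> countable (A `|` B).
Proof.
move=> cA cB; have -> : A `|` B = \bigcup_b (if b then A else B).
  apply/seteqP; split=> [x [Ax|Bx]|x [[] _]]; [by exists true|by exists false|by left|by right].
by apply: bigcup_countable => [|[]] //; exact: countableP.
Qed.

Lemma uncountableI_setC (T : Type) (J E : set T) :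
  ~ countable J -> countable (J `&` E) -> ~ countable (J `&` ~` E).
Proof.
move=> ncJ cE cNE; apply: ncJ.
by rewrite -(setIT J) -(setUv E) setIUr; apply: countable_setU.
Qed.

(** The weak form of the Delta-system lemma: the root D' bounds the pairwise
    intersections instead of being equal to them. *)
Lemma delta_system_rec (T : Type) (I : choiceType) (F : T -> {fset I}) (n : nat) :
  forall (D : {fset I}) (J : set T), ~ countable J ->
  (forall i, J i -> #|` (F i `\` D)%fset| <= n)%N ->
  exists (J' : set T) (D' : {fset I}), [/\ J' `<=` J, ~ countable J' &
    forall i j, J' i -> J' j -> i <> j -> (F i `&` F j `<=` D')%fset].
Proof.
elim: n => [|n IHn] D J ncJ leFn.
  exists J, D; split => // i j Ji _ _; apply/fsubsetP => a; rewrite inE => /andP[aFi _].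
  have := leFn i Ji; rewrite leqn0 cardfs_eq0 fsetD_eq0 => /fsubsetP; exact.
(* Let [M] be maximal with the sets [F i \ D] pairwise disjoint. If [M] is uncountable, [D] serves
   as root. Otherwise these sets cover only countably many points; by maximality uncountably many
   [F i \ D] share one of them, [a], and moving [a] into [D] lowers the bound [n]. *)
have [M [MJ tM maxM]] :=
  ex_maximal_disjoint_subcollection (fun i => [set` (F i `\` D)%fset]) J.
have [cM|ncM] := pselect (countable M); last first.
  exists M, D; split => // i j Mi Mj ij; apply/fsubsetP => a; rewrite inE => /andP[aFi aFj].
  apply: contrapT => /negP aD; apply: ij; apply: tM => //; exists a.
  by split; rewrite /= !inE aD.
pose W := \bigcup_(i in M) [set` (F i `\` D)%fset].
have cW : countable W.
  by apply: bigcup_countable => // i _; exact: finite_set_countable.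
pose Ja a := J `&` [set i | a \in (F i `\` D)%fset].
have [a [Wa ncJa]] : exists a, W a /\ ~ countable (Ja a).
  apply: contrapT => /forallNP cJa; apply: ncJ.
  apply: (@sub_countable _ _ _ (M `|` \bigcup_(a in W) Ja a)).
    apply: subset_card_le => i Ji; have [|Mi] := pselect (M i); first by left.
    right; apply: contrapT => nWi; apply: (maxM (M `|` [set i])).
    - by split; [exact: subsetUl|move=> /(_ i (or_intror erefl))].
    - by move=> j [/MJ|->].
    - move=> j k [Mj|->] [Mk|->] // [a [ja ka]].
      + by apply: tM => //; exists a.
      + by exfalso; apply: nWi; exists a; [exists j|split].
      + by exfalso; apply: nWi; exists a; [exists k|split].
  apply: countable_setU => //; apply: bigcup_countable => // a Wa.
  by apply: contrapT => ncJa; apply: (cJa a).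
have [|J' [D' [J'J ncJ' J'D']]] := IHn (a |` D)%fset (Ja a) ncJa.
  move=> i [Ji /= aFi]; have := leFn i Ji.
  by rewrite (cardfsD1 a) aFi add1n ltnS fsetDDl fsetUC.
by exists J', D'; split=> // i /J'J[].
Qed.

Lemma delta_system (T : Type) (I : choiceType) (F : T -> {fset I}) (J : set T) :
  ~ countable J ->
  exists (J' : set T) (D : {fset I}), [/\ J' `<=` J, ~ countable J' &
    forall i j, J' i -> J' j -> i <> j -> (F i `&` F j `<=` D)%fset].
Proof.
(* The recursion needs a common bound on the cardinalities, so pass to uncountably many sets of one
   size. *)
move=> /(@uncountable_fiber _ _ (fun i => #|` F i|))[n ncn].
have [|J' [D [J'J ncJ' J'D]]] := @delta_system_rec _ _ F n fset0 _ ncn.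
  by move=> i [_ /= <-]; rewrite fsetD0.
by exists J', D; split=> // i /J'J[].
Qed.

(** * Centered sequences from the chain condition *)

(** By ccc, a maximal [M] for which the traces of the [W i] on [V] are pairwise disjoint is
    countable. The trace of every [W j] meets one of these; if each were met by countably many only,
    [J] would be countable. *)
Lemma ccc_uncountable_meet (T : topologicalType) (K V : set T) (S : Type)
    (W : S -> set T) (J : set S) :
  ccc K -> ~ countable J -> open_in K V ->
  (forall i, J i -> open_in K (W i) /\ V `&` W i !=set0) ->
  exists2 i, J i & ~ countable (J `&` [set j | V `&` W i `&` W j !=set0]).
Proof.
move=> cccK ncJ [A [oA VE]] JW.
have [M [MJ tM maxM]] := ex_maximal_disjoint_subcollection (fun i => V `&` W i) J.
have cM : countable M.
  have MW : set_inj M (fun i => V `&` W i).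
    by apply: trivIset_inj tM => i /MJ/JW[].
  rewrite -(eq_countable (inj_card_eq MW)); apply: cccK => [_ [i /MJ/JW[[B [oB ->]] VWi] <-]|].
    split=> //; exists (A `&` B); split; first exact: openI.
    by rewrite VE setIACA setIid.
  move=> _ _ [i Mi <-] [j Mj <-] ij; apply/seteqP; split => // t tij.
  by apply: ij; rewrite (tM i j Mi Mj) //; exists t.
apply: contrapT => /forall2NP nJ; apply: ncJ.
apply: (@sub_countable _ _ _ (\bigcup_(i in M) (J `&` [set j | V `&` W i `&` W j !=set0]))).
  apply: subset_card_le => j Jj; apply: contrapT => nj.
  have [_ [t tj]] := JW _ Jj.
  have Mj : ~ M j.
    by move=> Mj; apply: nj; exists j => //; split=> //; exists t; split => //; exact: tj.2.
  apply: (maxM (M `|` [set j])).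
  - by split; [exact: subsetUl|move=> /(_ j (or_intror erefl))].
  - by move=> k [/MJ|->].
  - move=> k l [Mk|->] [Ml|->] // [s [sk sl]].
    + by apply: tM => //; exists s.
    + by exfalso; apply: nj; exists k => //; split=> //; exists s; split => //; exact: sl.2.
    + by exfalso; apply: nj; exists l => //; split=> //; exists s; split => //; exact: sk.2.
apply: bigcup_countable => // i /MJ Ji; apply: contrapT => nci.
by case: (nJ i).
Qed.

(** The preceding lemma is iterated: each pick leaves uncountably many candidates whose sets still
    meet the intersection formed so far, so the recursion never stops. *)
Lemma ccc_centered_sequence (T : topologicalType) (K : set T) (S : Type)
    (W : S -> set T) (J : set S) :
  ccc K -> ~ countable J -> (forall i, J i -> open_in K (W i) /\ W i !=set0) ->
  exists e : nat -> S, [/\ injective e, forall n, J (e n) &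
    forall n, exists y, forall k, (k < n)%N -> W (e k) y].
Proof.
move=> cccK ncJ JW.
pose inv (s : set T * set S * S) := [/\ open_in K s.1.1, ~ countable s.1.2,
  s.1.2 `<=` J & forall i, s.1.2 i -> s.1.1 `&` W i !=set0].
pose next (s s' : {s | inv s}) := [/\ (sval s).1.2 (sval s').2,
  (sval s').1.1 = (sval s).1.1 `&` W (sval s').2 &
  (sval s').1.2 `<=` (sval s).1.2 `&` [set~ (sval s').2]].
(* A state (V, J', i) records the intersection V of the sets picked so far, the
   uncountably many remaining indices whose sets meet V, and the last pick. *)
have step s : {s' | next s s'}.
  apply: cid; case: s => [[[V J'] i0] /= [oV ncJ' J'J VJ']].
  have [|i Ji nci] := @ccc_uncountable_meet _ K V _ W J' cccK ncJ' oV.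
    by move=> i J'i; split; [exact: (JW _ (J'J _ J'i)).1|exact: VJ'].
  (* Discarding [i] itself makes the picks distinct. *)
  suff inv' : inv (V `&` W i, J' `&` [set j | V `&` W i `&` W j !=set0] `&` [set~ i], i).
    by exists (exist _ _ inv'); split => //= j [[]].
  split => /=.
  - have [A [oA /= VE]] := oV; have [[B [oB WE]] _] := JW _ (J'J _ Ji).
    by exists (A `&` B); split; [exact: openI|rewrite WE VE setIACA setIid].
  - apply: uncountableI_setC => //; apply: sub_countable (countable1 i).
    by apply: subset_card_le; exact: subIsetr.
  - by move=> j [[J'j _] _]; exact: J'J.
  - by move=> j [[_ Wj] _].
have [i0 [_ [_ _ _]]] := uncountable_two _ _ ncJ.
have inv0 : inv (K, J, i0).
  split => //=; first by exists setT; rewrite setIT; split; first exact: openT.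
  move=> i /JW[[A [_ ->]]] [t [Kt At]].
  by exists t.
have [st [st0 stS]] := dependent_choice step (exist _ _ inv0).
(* State 0 has picked nothing yet and carries an arbitrary [i0]; the first true pick is that of
   state 1. *)
pose e n := (sval (st n.+1)).2.
have Jmono m n : (m <= n)%N -> (sval (st n)).1.2 `<=` (sval (st m)).1.2.
  elim: n => [|n IHn]; first by rewrite leqn0 => /eqP->.
  rewrite leq_eqVlt => /predU1P[->//|/IHn]; apply: subset_trans.
  by have [_ _ /subset_trans] := stS n; apply => i [].
have elt m n : (m < n)%N -> e m <> e n.
  move=> mn emn; have [en _ _] := stS n; have [_ _ em] := stS m.
  by have [_] := em _ (Jmono _ _ mn _ en); apply.
exists e; split => [m n emn|n|n].
- by have [/elt|/elt|//] := ltngtP m n => /(_ _); rewrite emn.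
- have [+ _ _] := stS n; have [_ _ + _] := svalP (st n); exact.
- have VW : (sval (st n)).1.1 `<=` [set y | forall k, (k < n)%N -> W (e k) y].
    elim: n => [//|n IHn] y; have [_ -> _] := stS n => -[/IHn Wy Wny] k.
    by rewrite ltnS leq_eqVlt => /predU1P[->//|/Wy].
  have [_ ncn _ Vn] := svalP (st n).
  have [i [_ [/Vn[y [/VW Wy _]] _ _]]] := uncountable_two _ _ ncn.
  by exists y.
Qed.

(** * Copies of l^1 *)

(** As the [x n] are bounded and [X] is complete, a summable [a] yields an absolutely convergent
    series, and the estimates for finite sums pass to the limit. *)
Lemma contains_l1_of_lower_estimate (X : completeNormedModType R) (x : nat -> X) (M c : R) :
  0 < c -> (forall n, `|x n| <= M) ->
  (forall n (a : nat -> R),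
     c * \sum_(0 <= k < n) `|a k| <= `|\sum_(0 <= k < n) a k *: x k|) ->
  contains_l1 X.
Proof.
move=> c0 xM cx; pose u (a : nat -> R) k := a k *: x k.
have ncvg a : l1_seq a -> cvgn [normed series (u a)].
  move=> la; apply: (@series_le_cvg _ _ (fun k => M * `|a k|)).
  - by move=> k; exact: normr_ge0.
  - by move=> k; rewrite mulr_ge0 // (le_trans _ (xM 0%N)).
  - by move=> k; rewrite /u /= normrZ mulrC ler_wpM2r.
  - exact: (@is_cvg_seriesZ _ _ M la).
exists (fun a => limn (series (u a))), c, M; split => // [r a b la lb|a la].
  apply/cvg_lim => //.
  have -> : series (u (fun k => r * a k + b k)) = (fun n => r *: series (u a) n + series (u b) n).
    apply/funext => n; rewrite /series /= scaler_sumr -big_split /=.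
    by apply: eq_bigr => k _; rewrite /u scalerDl scalerA.
  by apply: cvgD; [apply: cvgZr|]; apply: normed_cvg; exact: ncvg.
have cua := normed_cvg (ncvg _ la); split.
  rewrite -lim_norm // /l1_norm.
  have -> : c * limn (series (fun k => `|a k|)) = limn (fun n => c * series (fun k => `|a k|) n).
    by apply/esym/cvg_lim; [exact: Rhausdorff|exact: cvgMr].
  apply: ler_lim.
  - by apply/cvg_ex; eexists; exact: cvgMr la.
  - exact: is_cvg_norm.
  - by apply: nearW => n; exact: cx.
apply: (le_trans (lim_series_norm (ncvg _ la))).
rewrite /l1_norm.
have -> : M * limn (series (fun k => `|a k|)) = limn (fun n => M * series (fun k => `|a k|) n).
  by apply/esym/cvg_lim; [exact: Rhausdorff|exact: cvgMr].
apply: ler_lim.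
- exact: ncvg.
- by apply/cvg_ex; eexists; exact: cvgMr la.
- apply: nearW => n; rewrite /series /= mulr_sumr; apply: ler_sum => k _.
  by rewrite /u /= normrZ mulrC ler_wpM2r.
Qed.

(** * Topology of the cube and dependence on finitely many coordinates *)

Section Cube.
Context {I : choiceType}.
Implicit Types (x y : cube I) (K : set (cube I)) (F : {fset I}).

Definition cylinder F x : set (cube I) := [set y | forall a, a \in F -> y a = x a].

Lemma cvg_cube (T : Type) (G : set_system T) (h : T -> cube I) x : Filter G ->
  (forall a, \forall t \near G, h t a = x a) -> h @ G --> x.
Proof.
move=> FG Gx; apply/cvg_sup => a A; rewrite nbhsE => -[B [[V oV <-] Bx] BA].
by apply: filterS (Gx a) => t hta; apply: BA; rewrite /= hta.
Qed.

Lemma nbhs_coord x (a : I) : \forall y \near x, y a = x a.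
Proof.
have /cvg_sup/(_ a) c : x --> x by exact: cvg_id.
apply: (c [set y | y a = x a]); rewrite nbhsE.
exists ((fun y : cube I => y a) @^-1` [set x a]); last by [].
by split => //; exists [set x a] => //; exact: discrete_open.
Qed.

Lemma nbhs_cylinder F x : nbhs x (cylinder F x).
Proof.
have := @filter_bigI _ I F (fun a y => y a = x a) (nbhs x) _ _.
by apply => a _; exact: nbhs_coord.
Qed.

(** The filter generated by the cylinders around [x] converges to [x] coordinatewise, hence contains
    every neighbourhood of [x]. *)
Lemma cylinder_nbhs x (A : set (cube I)) : nbhs x A -> exists F, cylinder F x `<=` A.
Proof.
pose G := filter_from [set: {fset I}] (cylinder^~ x).
have FG : Filter G.
  apply: filter_fromT_filter; first by exists fset0.
  move=> F F'; exists (F `|` F')%fset => y Fy.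
  by split=> a aF; apply: Fy; rewrite inE aF ?orbT.
have Gx : id @ G --> x.
  by apply: cvg_cube => a; exists [fset a]%fset => // y; apply; rewrite inE.
by move=> /Gx[F _ FA]; exists F.
Qed.

(** The adequate closure is the image of the compact product of [K] and the cube under the
    continuous coordinatewise meet [m]. *)
Lemma compact_adequate_closure K : compact K -> compact (adequate_closure K).
Proof.
move=> cK.
have cT : compact [set: cube I].
  have -> : [set: cube I] = [set f | forall a, [set: bool] (f a)] by apply/seteqP.
  exact: (@tychonoff I (fun _ => bool) (fun _ => setT) (fun _ => bool_compact)).
pose m (p : cube I * cube I) : cube I := fun a => p.1 a && p.2 a.
have -> : adequate_closure K = m @` (K `*` setT).
  apply/seteqP; split=> [x [y Ky xy]|_ [[y x] [/= Ky _] <-]].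
    exists (y, x) => //; apply/funext => a /=.
    by have := xy a; rewrite /m /=; case: (x a); case: (y a).
  by exists y; first exact: Ky; move=> a; rewrite /m /=; case: (y a); case: (x a).
apply: continuous_compact; last exact: compact_setX.
apply: continuous_subspaceT => p; apply: cvg_cube => a.
have near1 : \forall q \near p, q.1 a = p.1 a by exact: (cvg_fst (nbhs_coord p.1 a)).
have near2 : \forall q \near p, q.2 a = p.2 a by exact: (cvg_snd (nbhs_coord p.2 a)).
by apply: filterS2 near1 near2 => q; rewrite /m => -> ->.
Qed.

(** Serves twice: [Q y z] will say that a clopen set does not separate [y] from [z], or that a
    continuous function takes close values there. Locally some finite set of coordinates works; the
    near-covering form of compactness, along the filter of finite sets ordered by inclusion, gives
    one for all of [L]. *)
Lemma compact_finite_support L (Q : cube I -> cube I -> Prop) : compact L ->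
  (forall x, L x -> \forall y & z \near x, L y -> L z -> Q y z) ->
  exists F, forall y z, L y -> L z -> (forall a, a \in F -> y a = z a) -> Q y z.
Proof.
move=> /compact_near_coveringP/near_covering_withinP cL LQ.
pose G := filter_from [set: {fset I}] (fun F => [set F' | (F `<=` F')%fset]).
have FG : Filter G.
  apply: filter_fromT_filter; first by exists fset0.
  by move=> F F'; exists (F `|` F')%fset => F'' /=; rewrite fsubUset => /andP.
have [|F _ FL] := cL _ G (fun F y => forall z, L z -> cylinder F y z -> Q y z) FG.
  move=> x /LQ [[A B] /= [Ax Bx] ABQ].
  have [F FAB] := cylinder_nbhs _ _ (filterI Ax Bx).
  exists (cylinder F x, [set F' | (F `<=` F')%fset]) => /=.
    by split; [exact: nbhs_cylinder|exists F].
  move=> [y F'] /= [Fy /fsubsetP FF'] Ly z Lz yz; apply: (ABQ (y, z)) => //=.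
  by split; apply FAB => // a aF; rewrite yz ?Fy//; exact: FF'.
exists F => y z Ly Lz yz; apply: (FL F) => //=.
by move=> a /yz.
Qed.

End Cube.

(** * Separated points with a common meet, and their joins *)

Section Restriction.
Context {I : choiceType}.
Implicit Types (x y z : cube I) (K L : set (cube I)) (D : {fset I}).

Definition restr D x : cube I := fun a => (a \in D) && x a.

(** Codes the points supported in [D] by a countable type, as [uncountable_fiber] demands. *)
Definition extend D (p : {ffun D -> bool}) : cube I :=
  fun a => if insub a is Some b then p b else false.

Lemma extendE D x : extend D [ffun b => x (fsval b)] = restr D x.
Proof.
apply/funext => a; rewrite /extend /restr; case: insubP => [b -> <-|/negPf-> //].
by rewrite ffunE.
Qed.

Lemma uncountable_restr (S : Type) (w : S -> cube I) D (J : set S) :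
  ~ countable J -> exists z, ~ countable (J `&` [set i | restr D (w i) = z]).
Proof.
move=> /(@uncountable_fiber _ _ (fun i => [ffun b : D => w i (fsval b)])) [p ncp].
exists (extend D p); apply: contra_not ncp; apply: sub_countable.
by apply: subset_card_le => i [Ji /= ip]; split=> //=; rewrite -ip extendE.
Qed.

Lemma adequate_closure_le K x y :
  adequate_closure K y -> (forall a, x a ==> y a) -> adequate_closure K x.
Proof.
move=> [u Ku yu] xy; exists u => // a.
by have := xy a; have := yu a; case: (x a); case: (y a); case: (u a).
Qed.

Lemma clopen_finite_support L (U : set (cube I)) : compact L -> clopen_in L U ->
  exists D : {fset I}, forall x y, L x -> L y -> (forall a, a \in D -> x a = y a) -> U x <-> U y.
Proof.
move=> cL [UL [[A [oA UE]] [A' [oA' UE']]]].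
apply: (@compact_finite_support _ L (fun x y => U x <-> U y)) => // x Lx.
have [Ux|nUx] := pselect (U x).
  have Ax : nbhs x A by apply: open_nbhs_nbhs; split => //; move: Ux; rewrite UE => -[].
  exists (A, A) => //= -[y z] /= [Ay Az] Ly Lz.
  by rewrite UE; split.
have nUE y : L y -> A' y -> ~ U y.
  by move=> Ly A'y; have [] : (L `\` U) y by rewrite UE'.
have A'x : nbhs x A'.
  by apply: open_nbhs_nbhs; split => //; have [] : (L `&` A') x by rewrite -UE'.
exists (A', A') => //= -[y z] /= [A'y A'z] Ly Lz.
by split=> [/(nUE _ Ly A'y)|/(nUE _ Lz A'z)].
Qed.

(** Uncountably many supports form a Delta-system with root [D], and all but countably many of their
    sets separate some point from its restriction to [D]. Cutting that point down to [D] and the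
    support of the set gives [w U]; [z] is a restriction to [D] shared by uncountably many of them.
    Off [D] these have disjoint supports, so their meets are [z]. *)
Lemma uncountable_clopen_split L (B : set (set (cube I))) : compact L ->
  (forall x y, L y -> (forall a, x a ==> y a) -> L x) ->
  (forall U, B U -> clopen_in L U) -> ~ countable B ->
  exists (J : set (set (cube I))) (w : set (cube I) -> cube I)
      (z : cube I) (F : set (cube I) -> {fset I}),
    [/\ J `<=` B, ~ countable J, L z,
      forall U, J U -> [/\ L (w U), ~ (U (w U) <-> U z) & forall a, w U a -> a \in F U] &
      forall U V, J U -> J V -> U <> V -> forall a, w U a && w V a = z a].
Proof.
move=> cL dL clB ncB.
have LR D x : L x -> L (restr D x).
  by move=> /dL; apply => a; rewrite /restr; case: (_ \in _); case: (x a).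
have /choice[F BF] : forall U, exists F : {fset I}, B U ->
    forall x y, L x -> L y -> (forall a, a \in F -> x a = y a) -> U x <-> U y.
  move=> U; have [/clB/(clopen_finite_support _ _ cL)[F UF]|nBU] := pselect (B U).
    by exists F.
  by exists fset0.
have [J1 [D [J1B ncJ1 J1D]]] := delta_system _ _ F B ncB.
(* A flat U is determined by its trace on the finitely many points supported in
   D, so only countably many U are flat. *)
pose flat U := forall x, L x -> U x <-> U (restr D x).
have cflat : countable (J1 `&` flat).
  apply: contrapT => /(@uncountable_fiber _ _
    (fun U => [ffun p : {ffun D -> bool} => `[< U (extend D p) >]]))[h].
  move=> /uncountable_two[U [V [[[/J1B/clB[UL _] fU] Uh] [[/J1B/clB[VL _] fV] Vh]]]]; apply.
  have UV x : U (restr D x) <-> V (restr D x).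
    have : [ffun p : {ffun D -> bool} => `[< U (extend D p) >]] [ffun b => x (fsval b)] =
      [ffun p : {ffun D -> bool} => `[< V (extend D p) >]] [ffun b => x (fsval b)].
      by congr fun_of_fin; rewrite Uh Vh.
    rewrite !ffunE extendE => UVx.
    by split=> /asboolP; [rewrite UVx|rewrite -UVx] => /asboolP.
  apply/seteqP; split => x Wx; have Lx : L x by auto.
    exact: (fV x Lx).2 ((UV x).1 ((fU x Lx).1 Wx)).
  exact: (fU x Lx).2 ((UV x).2 ((fV x Lx).1 Wx)).
have ncJ2 := uncountableI_setC _ _ _ ncJ1 cflat.
have /choice[w0 w0P] : forall U, exists w, (J1 `&` ~` flat) U ->
    L w /\ ~ (U w <-> U (restr D w)).
  move=> U; have [[_ /existsNP[w /not_implyP[Lw Uw]]]|nU] := pselect ((J1 `&` ~` flat) U).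
    by exists w.
  by exists (fun=> false).
pose w U := restr (D `|` F U)%fset (w0 U).
have [z ncJ3] := uncountable_restr _ w D _ ncJ2.
have wD U : restr D (w U) = restr D (w0 U).
  by apply/funext => a; rewrite /w /restr inE; case: (a \in D).
have wz U a : restr D (w U) = z -> a \in D -> w U a = z a.
  by move=> <- aD; rewrite [RHS]/restr aD.
exists (J1 `&` ~` flat `&` [set U | restr D (w U) = z]), w, z, (fun U => D `|` F U)%fset.
split => //.
- by move=> U [[/J1B]].
- have [U [_ [[JU <-] _ _]]] := uncountable_two _ _ ncJ3.
  by apply/LR/LR; have [] := w0P _ JU.
- move=> U [JU /= <-]; have [Lw0 Uw0] := w0P _ JU; split.
  + exact: LR.
  + rewrite wD; apply: contra_not Uw0; apply: iff_trans.
    apply: (BF _ (J1B _ JU.1)) => //; first exact: LR.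
    by move=> a aF; rewrite /w /restr inE aF orbT.
  + by move=> a /andP[].
- move=> U V [JU /= Uz] [JV /= Vz] UV a.
  have [aD|aD] := boolP (a \in D); first by rewrite (wz _ _ Uz aD) (wz _ _ Vz aD) andbb.
  rewrite -[in RHS]Uz /restr (negPf aD) /=; apply/negP => /andP[].
  rewrite /w /restr !inE (negPf aD) /= => /andP[aU _] /andP[aV _].
  have /fsubsetP/(_ a) := J1D U V JU.1 JV.1 UV.
  by rewrite inE aU aV (negPf aD) => /(_ isT).
Qed.

Lemma open_upset (w : cube I) (F : {fset I}) : (forall a, w a -> a \in F) ->
  open [set y : cube I | forall a, w a ==> y a].
Proof.
move=> wF; rewrite openE => y wy; apply: filterS (nbhs_cylinder F y) => x Fx a.
by apply/implyP => wa; rewrite (Fx _ (wF _ wa)); exact: (implyP (wy a)).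
Qed.

(** [G i] stands for the coordinates that matter to the function attached to [i]. The witness [t] is
    the join of [z] with the [w (e k)] for which [s k] holds; it lies below a point of [K] because
    the sets of points of [K] above the [w (e k)] are centered. *)
Lemma ccc_independent_sequence K (S : Type) (J : set S) (w : S -> cube I) z
    (F G : S -> {fset I}) :
  ccc K -> ~ countable J -> (forall i, J i -> adequate_closure K (w i)) ->
  (forall i, J i -> forall a, w i a -> a \in F i) ->
  (forall i j, J i -> J j -> i <> j -> forall a, w i a && w j a = z a) ->
  exists e : nat -> S, (forall n, J (e n)) /\
    forall n (s : nat -> bool), exists2 t, adequate_closure K t &
      forall i a, (i < n)%N -> a \in G (e i) -> t a = if s i then w (e i) a else z a.
Proof.
move=> cccK ncJ Kw wF wz.
have [J1 [D [J1J ncJ1 J1D]]] := delta_system _ _ (fun i => F i `|` G i)%fset J ncJ.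
have [v ncJ2] := uncountable_restr _ w D _ ncJ1.
set J2 := J1 `&` _ in ncJ2.
have J2J i : J2 i -> J i by move=> [/J1J].
(* Such an [a] belongs to the root [D], where [w i] and [w j] agree; hence it lies in both supports,
   and the meet of [w i] and [w j] is [z]. *)
have wG i j a : J2 i -> J2 j -> i <> j -> a \in G i -> w j a -> z a.
  move=> Ji Jj ij aGi wja; rewrite -(wz i j) ?wja ?andbT; try by [apply: J2J|].
  have aD : a \in D.
    apply: (fsubsetP (J1D i j Ji.1 Jj.1 ij)); rewrite !inE aGi orbT /=.
    by rewrite (wF _ (J2J _ Jj)).
  have /(congr1 (fun x : cube I => x a)) : restr D (w i) = restr D (w j) by rewrite Ji.2 Jj.2.
  by rewrite /restr aD wja.
have [|e [e_inj Je eK]] :=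
  ccc_centered_sequence _ K _ (fun i => K `&` [set y | forall a, w i a ==> y a]) J2 cccK ncJ2.
  move=> i /J2J Ji; split; last by have [y Ky wy] := Kw _ Ji; exists y.
  by exists [set y | forall a, w i a ==> y a]; split => //; apply: open_upset (wF _ Ji).
have ew i j a : i <> j -> w (e i) a && w (e j) a = z a.
  by move=> ij; apply: wz; [exact: J2J|exact: J2J|move=> /e_inj].
exists e; split=> [n|n s]; first exact: J2J.
exists (fun a => z a || [exists k : 'I_n, s k && w (e k) a]).
  (* With [n.+1] sets, [y] lies above [w (e n)] and so above [z], even for [n = 0]. *)
  have [y ye] := eK n.+1; exists y; first by have [] := ye n (ltnSn n).
  move=> a; apply/implyP => /orP[za|/existsP[k /andP[_ wk]]].
    have [_ /(_ a)/implyP] := ye n (ltnSn n); apply.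
    by move: za; rewrite -(ew n n.+1 a); [case/andP|exact: n_Sn].
  by have [_ /(_ a)/implyP] := ye k (ltnW (ltn_ord k)); apply.
move=> i a lin aG; have [za|nza] := boolP (z a).
  by move: za; rewrite -(ew i i.+1 a) /=; [case/andP=> ->|exact: n_Sn]; rewrite if_same.
rewrite /=; apply/existsP/idP => [[k /andP[sk wk]]|].
  have [ik|/eqP ik] := eqVneq i k; first by rewrite ik sk.
  by move: nza; rewrite (wG (e i) (e k) a) // => /e_inj.
by case: ifP => // si wi; exists (Ordinal lin); rewrite /= si.
Qed.

End Restriction.

(** * Uniform bounds for compact sets of functionals *)

(** Compactness bounds the values at each point [x]; by Banach-Steinhaus the functionals are
    uniformly bounded on the unit ball, and scaling gives [N]. *)
Lemma compact_functionals_bounded (K : realType) (X : completeNormedModType K)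
    (H : set {ptws X -> K}) : compact H ->
  (forall h, H h -> linear_for *%R (h : X -> K) /\ continuous (h : X -> K)) ->
  exists2 N, 0 < N & forall h, H h -> forall x, `|h x| <= N * `|x|.
Proof.
move=> cH HL.
pose lin h (Hh : H h) : {linear X -> K^o} :=
  HB.pack (h : X -> K^o) (GRing.isLinear.Build _ X K^o _ (h : X -> K^o) (HL h Hh).1).
have bnd h (Hh : H h) : exists2 r, 0 <= r & forall x, `|h x| <= r * `|x|.
  have : bounded_near (lin h Hh) (nbhs (0 : X)).
    by apply: continuous_linear_bounded; exact: (HL h Hh).2.
  move=> /linear_boundedP[r [_ rh]]; exists (`|r| + 1) => [|x]; first by rewrite addr_ge0.
  by apply: rh; rewrite (le_lt_trans (ler_norm r)) // ltrDl.
have [|x|M MH] := @Banach_Steinhauss K X K^o H _ _ 1.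
- move=> h Hh; split; last exact: (HL h Hh).1.
  have [r r0 rh] := bnd h Hh.
  by move=> s; exists (r * s) => x xs; rewrite (le_trans (rh x)) // ler_wpM2l.
- have : compact ((fun h : {ptws X -> K} => h x) @` H).
    apply: continuous_compact => //; apply: continuous_subspaceT.
    exact: (@proj_continuous X (fun _ => K) x).
  move=> /(@compact_bounded K K^o)[M [_ HM]]; exists (M + 1) => h Hh.
  by apply: (HM (M + 1)); [rewrite ltrDl|exists h].
exists (`|M| + 1); first by rewrite ltr_pwDr.
move=> h Hh x; have [->|x0] := eqVneq x 0.
  have [r _ /(_ 0)] := bnd h Hh; rewrite normr0 mulr0 => /le_trans; apply.
  by rewrite mulr0.
have nx0 : 0 < `|x| by rewrite normr_gt0.
have := MH h Hh (`|x|^-1 *: x).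
rewrite normrZ normfV normr_id mulVf ?gt_eqF // => /(_ (lexx 1)).
have -> : h (`|x|^-1 *: x) = `|x|^-1 * h x by exact: (linearZZ (lin h Hh)).
rewrite normrM normfV normr_id ler_pdivrMl // mulrC => /le_trans; apply.
by rewrite ler_wpM2r // (le_trans (ler_norm M)) // lerDl.
Qed.

Lemma linear_for_sum (K : realType) (X : lmodType K) (h : X -> K) (x : nat -> X)
    (a : nat -> K) n : linear_for *%R h ->
  h (\sum_(0 <= k < n) a k *: x k) = \sum_(0 <= k < n) a k * h (x k).
Proof.
move=> hlin; elim: n => [|n IHn].
  rewrite !big_geq //; have := hlin 1 0 0.
  rewrite scale1r addr0 mul1r => /(congr1 (fun r => r - h 0)).
  by rewrite subrr addrK.
by rewrite !big_nat_recr //= addrC hlin IHn addrC.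
Qed.

(** * The canonical map to the Stone space *)

(** Evaluation at [t]; the conjunct [B U] fixes the coordinates outside [B] to false, as in
    [stone_space]. *)
Definition stone_point (T : Type) (B : set (set T)) (t : T) :
  prod_topology (fun _ : set T => bool) := fun U => `[< B U /\ U t >].

Lemma stone_pointP (T : topologicalType) (L : set T) (B : set (set T)) t :
  clopen_subalgebra L B -> L t -> stone_space L B (stone_point T B t).
Proof.
move=> [clB B0 BL BU BC] Lt; split.
- exact/asboolP.
- by apply/asboolP => -[].
- move=> U V HU HV; apply/asboolP/orP => [[_ [Ut|Vt]]|[/asboolP[_ Ut]|/asboolP[_ Vt]]].
  + by left; apply/asboolP.
  + by right; apply/asboolP.
  + by split; [exact: BU|left].
  + by split; [exact: BU|right].
- move=> U HU; apply/asboolP/negP => [[_ [_ nUt]] /asboolP[]//|nUt].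
  by split; [exact: BC|split=> // Ut; apply: nUt; apply/asboolP].
- by move=> U nU; apply/asboolP => -[].
Qed.

Lemma stone_point_continuous (T : topologicalType) (L : set T) (B : set (set T)) t :
  clopen_subalgebra L B -> L t ->
  stone_point T B @ within L (nbhs t) --> stone_point T B t.
Proof.
move=> [clB _ _ _ _] Lt; apply: (@cvg_cube (set T)) => U.
have [HU|nU] := pselect (B U); last first.
  by apply: nearW => s; apply/asboolP/asboolP => -[].
have [UL [[A [oA UE]] [A' [oA' UE']]]] := clB _ HU.
have [Ut|nUt] := pselect (U t).
  have : nbhs t A by apply: open_nbhs_nbhs; split => //; move: Ut; rewrite UE => -[].
  apply: filterS => s As Ls; rewrite /stone_point !asboolT //.
  by split => //; rewrite UE.
have : nbhs t A'.
  by apply: open_nbhs_nbhs; split => //; have [] : (L `&` A') t by rewrite -UE'.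
apply: filterS => s As Ls; rewrite /stone_point !asboolF // => -[] //.
by have [] : (L `\` U) s by rewrite UE'.
Qed.

(** * From a WRN subalgebra to a copy of l^1 *)

(** Puts continuity relative to [L] in the form that [compact_finite_support] takes. *)
Lemma near_pair_close (K : realType) (T : topologicalType) (L : set T) (g : T -> K)
    (x : T) (eps : K) :
  0 < eps -> g @ within L (nbhs x) --> g x ->
  \forall y & z \near x, L y -> L z -> `|g y - g z| <= eps.
Proof.
move=> eps0 gx.
have e2 : 0 < eps / 2 by rewrite divr_gt0.
have {}gx : \forall t \near within L (nbhs x), `|g x - g t| < eps / 2.
  by move/cvgrPdist_lt : gx; apply.
exists ([set y | L y -> `|g x - g y| < eps / 2], [set y | L y -> `|g x - g y| < eps / 2]).
  by split; exact: gx.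
move=> -[y z] /= [gy gz] /gy {}gy /gz {}gz.
have -> : g y - g z = (g x - g z) - (g x - g y) by ring.
by rewrite (le_trans (ler_normB _ _)) // (splitr eps) lerD // ltW.
Qed.

Lemma adequate_closure_WRNB_perp (I : choiceType) (K : set (cube I)) :
  compact K -> ccc K -> in_WRNB_perp (adequate_closure K).
Proof.
move=> cK cccK B clB ncB [X [f [nl1 flc finj fcont [cf _]]]]; apply: nl1.
set L := adequate_closure K in clB flc finj fcont cf.
pose pi := stone_point (cube I) B.
have Lpi t : L t -> stone_space L B (pi t) by move=> Lt; exact: stone_pointP.
have linf t : L t -> linear_for *%R (f (pi t)) by move=> /Lpi/flc[].
have cL : compact L by exact: compact_adequate_closure.
have [BL _ _ _ _] := clB.
have [|J [w [z [F [JB ncJ Lz Jw wz]]]]] := uncountable_clopen_split _ _ cL _ BL ncB.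
  by move=> x y; exact: adequate_closure_le.
(* [U] separates [w U] from [z], so their images under [pi] differ, and by injectivity of [f] the
   two functionals differ at some [v]; rescaling [v] makes the difference 1. *)
have /choice[x xP] : forall U, exists x, J U -> f (pi (w U)) x - f (pi z) x = 1.
  move=> U; have [JU|nJU] := pselect (J U); last by exists 0.
  have [Lw Uw _] := Jw _ JU.
  have /existsNP[v fv] : ~ forall v, f (pi (w U)) v = f (pi z) v.
    move=> fwz; have {fwz} : f (pi (w U)) = f (pi z) by exact/funext.
    move=> /(finj _ _ (Lpi _ Lw) (Lpi _ Lz)) /(congr1 (fun h => h U)) wzU; apply: Uw.
    have BU := JB _ JU; split => [Uw|Uz].
      by have /asboolP[] : pi z U by rewrite -wzU; apply/asboolP.
    by have /asboolP[] : pi (w U) U by rewrite wzU; apply/asboolP.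
  exists ((f (pi (w U)) v - f (pi z) v)^-1 *: v) => _.
  have fZ t c : L t -> f (pi t) (c *: v) = c * f (pi t) v.
    by move=> Lt; have := linear_for_sum _ _ _ (fun=> v) (fun=> c) 1 (linf _ Lt); rewrite !big_nat1.
  by rewrite !fZ // -mulrBr mulVf // subr_eq0; apply/eqP.
(* Pigeonhole on the integer part of the norm bounds the remaining [x U] by [m + 1]. *)
have [m ncm] := uncountable_fiber _ _ (fun U => Num.truncn `|x U|) J ncJ.
set J1 := J `&` _ in ncm.
have J1J U : J1 U -> J U by case.
have [N N0 fN] : exists2 N, 0 < N &
    forall h, (f @` stone_space L B) h -> forall v, `|h v| <= N * `|v|.
  apply: compact_functionals_bounded => // _ [t St <-]; exact: flc.
have gcont v t : L t -> (fun s => f (pi s) v) @ within L (nbhs t) --> f (pi t) v.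
  move=> Lt.
  have piS : pi @ within L (nbhs t) --> within (stone_space L B) (nbhs (pi t)).
    move=> A /(stone_point_continuous _ _ _ _ clB Lt).
    by apply: (@filterS _ (nbhs t)) => s piA Ls; exact: piA Ls (Lpi _ Ls).
  have fpi := cvg_comp _ _ piS ((subspace_continuousP _ _).1 fcont (pi t) (Lpi _ Lt)).
  exact: cvg_comp _ _ fpi (@proj_continuous X (fun=> R) v (f (pi t))).
(* The tolerance 1/4 is spent at two points, so that of a difference 1 at least 1/2 remains. *)
have /choice[G GP] : forall U, exists G : {fset I}, forall y y', L y -> L y' ->
    (forall a, a \in G -> y a = y' a) -> `|f (pi y) (x U) - f (pi y') (x U)| <= 4^-1.
  move=> U; apply: (compact_finite_support L (fun y y' =>
     `|f (pi y) (x U) - f (pi y') (x U)| <= 4^-1)) => // t Lt.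
  by apply: near_pair_close => //; exact: gcont.
have [|U /J1J|U V /J1J JU /J1J JV|e [Je eK]] :=
    ccc_independent_sequence K _ J1 w z F G cccK ncm.
- by move=> U /J1J/Jw[].
- by move=> /Jw[].
- exact: wz.
(* The functionals at [p] and [q] below differ on [v] by at most [2 N |v|] and by at least half the
   sum of the [|a k|], whence the constant. *)
apply: (contains_l1_of_lower_estimate X (x \o e) m.+1%:R (4 * N)^-1).
- by rewrite invr_gt0 mulr_gt0.
- by move=> n; have [_ /= <-] := Je n; rewrite ltW // truncnS_gt.
move=> n a.
(* On [G (e k)], [p] follows [w (e k)] if [a k >= 0] and [z] otherwise, while [q] does the opposite;
   so each term of the difference is at least [|a k| / 2]. *)
have [p Lp pE] := eK n (fun k => 0 <= a k).
have [q Lq qE] := eK n (fun k => a k < 0).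
set v := \sum_(0 <= k < n) a k *: (x \o e) k.
have fv t : L t -> `|f (pi t) v| <= N * `|v| by move=> /Lpi St; apply: fN; exists (pi t).
suff : \sum_(0 <= k < n) `|a k| / 2 <= f (pi p) v - f (pi q) v.
  rewrite -mulr_suml => le_v; rewrite ler_pdivrMl ?mulr_gt0 //.
  have := le_trans (ler_norm _) (fv _ Lp); have := le_trans (ler_norm _) (fv _ Lq).
  have : - f (pi q) v <= N * `|v|.
    by apply: le_trans (fv _ Lq); rewrite -normrN ler_norm.
  move: le_v; lra.
rewrite !linear_for_sum; try exact: linf.
rewrite -sumrB; apply: ler_sum_nat => k /andP[_ kn].
have [JU _] := Je k; have [Lw _ _] := Jw _ JU; have xk := xP _ JU.
have close t : L t -> forall b, (forall i c, (i < n)%N -> c \in G (e i) ->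
    t c = if b i then w (e i) c else z c) ->
    `|f (pi t) (x (e k)) - f (pi (if b k then w (e k) else z)) (x (e k))| <= 4^-1.
  move=> Lt b tb; apply: GP => //; first by case: (b k).
  by move=> c cG; rewrite (tb k c kn cG); case: (b k).
have := close _ Lp _ pE; have := close _ Lq _ qE => /=.
rewrite !ler_norml -mulrBr => /andP[q1 q2] /andP[p1 p2].
have [a0|a0] := leP 0 (a k); move: q1 q2 p1 p2.
  rewrite a0 (ltNge (a k)) a0 /= => q1 q2 p1 p2.
  by rewrite ger0_norm // ler_wpM2l //; lra.
rewrite (leNgt 0) a0 /= => q1 q2 p1 p2.
by rewrite ltr0_norm // mulNr -mulrN ler_nM2l //; lra.
Qed.

Theorem theorem5p3 (I : Type) (K : set (cube I)) :
  compact K -> ccc K -> in_WRNB_perp (adequate_closure K).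
(* [{classic I}] equips [I] with the choice structure that finite sets of coordinates require. *)
Proof. exact: (@adequate_closure_WRNB_perp {classic I} K). Qed.
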